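(* Let $n\ge 3$, $\eta,\chi_1,\chi_2\in\mathbb R$, and let $\gamma_1,\gamma_2\in\mathbb R^n$ be fixed unit vectors. Consider on $(T^*V_{n,2},\omega_\eta)$ the Hamiltonian system of $$H_\kappa=\tfrac12\langle \mathbf p_1,\mathbf p_1\rangle+\tfrac12\langle \mathbf p_2,\mathbf p_2\rangle-(1+2\kappa)\langle \mathbf p_1,\mathbf e_2\rangle\langle \mathbf p_2,\mathbf e_1\rangle+V_{II}(\mathbf e_1,\mathbf e_2),\qquad \kappa=1,$$ with potential $V_{II}(\mathbf e_1,\mathbf e_2)=\chi_1\langle\gamma_1,\mathbf e_1\rangle+\chi_2\langle\gamma_2,\mathbf e_2\rangle$. The Hamiltonian equations imply the matrix equations $$\frac{d}{dt}\mathcal L(\lambda)=[\mathcal L(\lambda),\mathcal A(\lambda)]$$ with a spectral parameter $\lambda$, where $\mathcal L(\lambda)$ and $\mathcal A(\lambda)$ are the $so(n+2)$ matrices $$\mathcal L(\lambda)=\begin{pmatrix} -\lambda\Phi_\eta & \mathbf e_1+\lambda^2\chi_1\gamma_1 & \mathbf e_2+\lambda^2\chi_2\gamma_2\\ -\mathbf e_1^T-\lambda^2\chi_1\gamma_1^T & 0 & \lambda(\Psi-\eta)\\ -\mathbf e_2^T-\lambda^2\chi_2\gamma_2^T & \lambda(\eta-\Psi) & 0\end{pmatrix},$$ $$\mathcal A(\lambda)=\begin{pmatrix} -\Phi_\eta & \lambda\chi_1\gamma_1 & \lambda\chi_2\gamma_2\\ -\lambda\chi_1\gamma_1^T & 0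 & \Psi-\eta\\ -\lambda\chi_2\gamma_2^T & \eta-\Psi & 0\end{pmatrix}.$$
   Context: **Stiefel variety and cotangent bundle.** $V_{n,2}=\{(\mathbf e_1,\mathbf e_2)\in\mathbb R^{n}\times\mathbb R^n : \langle \mathbf e_1,\mathbf e_1\rangle=\langle \mathbf e_2,\mathbf e_2\rangle=1,\ \langle \mathbf e_1,\mathbf e_2\rangle=0\}$. Its cotangent bundle is realized as the set of $(\mathbf e_1,\mathbf e_2,\mathbf p_1,\mathbf p_2)\in\mathbb R^{4n}$ with $(\mathbf e_1,\mathbf e_2)\in V_{n,2}$ and $\langle \mathbf e_1,\mathbf p_1\rangle=0$, $\langle \mathbf e_2,\mathbf p_2\rangle=0$, $\langle \mathbf e_1,\mathbf p_2\rangle+\langle \mathbf e_2,\mathbf p_1\rangle=0$. **Twisted symplectic form.** $\omega_\eta$ is the restriction to $T^*V_{n,2}$ of $\sum_i \big(dp_1^i\wedge de_1^i+dp_2^i\wedge de_2^i\big)+\eta\sum_i de_1^i\wedge de_2^i$. The sign convention for Hamiltonian vector fields is that in the ambient space $\mathbb R^{4n}$ the equations of $H$ are $\dot{\mathbf e}_i=\partial H/\partial\mathbf p_i$, $\dot{\mathbf p}_1=-\partial H/\partial\mathbf e_1+\eta\,\partial H/\partial\mathbf p_2$, $\dot{\mathbf p}_2=-\partial H/\partial\mathbf e_2-\eta\,\partial H/\partial\mathbf p_1$; on $T^*V_{n,2}$ one takes the Hamiltonian vector field of the restriction of $H$ to the symplectic submanifold $(T^*V_{n,2},\omega_\eta)$.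 **Notation.** Vectors in $\mathbb R^n$ are columns and $x\wedge y=xy^T-yx^T\in so(n)$. $\Phi_\eta=\mathbf p_1\wedge \mathbf e_1+\mathbf p_2\wedge \mathbf e_2+\eta\,\mathbf e_1\wedge \mathbf e_2$ and $\Psi=\langle \mathbf e_1,\mathbf p_2\rangle-\langle \mathbf e_2,\mathbf p_1\rangle$. $[A,B]=AB-BA$. *)

(* Defs.v *)
From mathcomp Require Import all_boot all_order all_algebra.
From mathcomp Require Import all_classical all_reals all_analysis.

Set Implicit Arguments.
Unset Strict Implicit.
Unset Printing Implicit Defensive.

Import Order.TTheory GRing.Theory Num.Theory.
Import numFieldNormedType.Exports.

Local Open Scope classical_set_scope.
Local Open Scope ring_scope.

(* The ambient space R^{4n}; a point is (e1, e2, p1, p2), and so is a tangent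
   vector, whose components are then the values of de1, de2, dp1, dp2. *)
Notation phase R n := ('cV[R]_n * 'cV[R]_n * 'cV[R]_n * 'cV[R]_n)%type.

Section definitions.
Context {R : realType} {n : nat}.
Implicit Types (x y : 'cV[R]_n) (z w X Y : phase R n).

Definition dotp x y : R := \sum_(i < n) x i 0 * y i 0.

Definition wedge x y : 'M[R]_n := x *m y^T - y *m x^T.

Definition commutator m (A B : 'M[R]_m) : 'M[R]_m := A *m B - B *m A.

Definition e1 z : 'cV[R]_n := z.1.1.1.
Definition e2 z : 'cV[R]_n := z.1.1.2.
Definition p1 z : 'cV[R]_n := z.1.2.
Definition p2 z : 'cV[R]_n := z.2.

Definition stiefel2 : set ('cV[R]_n * 'cV[R]_n) :=
  [set e | [/\ dotp e.1 e.1 = 1, dotp e.2 e.2 = 1 & dotp e.1 e.2 = 0]].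

Definition cotangent_stiefel2 : set (phase R n) :=
  [set z | [/\ stiefel2 (e1 z, e2 z), dotp (e1 z) (p1 z) = 0,
               dotp (e2 z) (p2 z) = 0 &
               dotp (e1 z) (p2 z) + dotp (e2 z) (p1 z) = 0]].

(* The six equations cutting out the cotangent bundle have linearly independent
   differentials at each of its points z, so that its tangent space at z is
   their common kernel. *)
Definition tangent_cotangent z : set (phase R n) :=
  [set X | [/\ 'd (fun w => dotp (e1 w) (e1 w)) z X = 0 :> R,
               'd (fun w => dotp (e2 w) (e2 w)) z X = 0 :> R &
               'd (fun w => dotp (e1 w) (e2 w)) z X = 0 :> R] /\
           [/\ 'd (fun w => dotp (e1 w) (p1 w)) z X = 0 :> R,
               'd (fun w => dotp (e2 w) (p2 w)) z X = 0 :> R &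
               'd (fun w => dotp (e1 w) (p2 w) + dotp (e2 w) (p1 w)) z X = 0
                 :> R]].

(* sum_i (dp1^i /\ de1^i + dp2^i /\ de2^i) + eta sum_i de1^i /\ de2^i,
   with (a /\ b)(X, Y) = a(X) b(Y) - a(Y) b(X). *)
Definition omega (eta : R) X Y : R :=
  (dotp (p1 X) (e1 Y) - dotp (p1 Y) (e1 X)) +
  (dotp (p2 X) (e2 Y) - dotp (p2 Y) (e2 X)) +
  eta * (dotp (e1 X) (e2 Y) - dotp (e1 Y) (e2 X)).

(* X is the value at z of the Hamiltonian vector field of the restriction of H
   to the cotangent bundle: X is tangent and i_X omega = - dH on tangent
   vectors. With this sign, letting Y range over the whole of R^{4n} gives
   e_i' = H_{p_i}, p1' = - H_{e1} + eta H_{p2}, p2' = - H_{e2} - eta H_{p1}. *)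
Definition hamiltonian_vector (eta : R) (H : phase R n -> R) z X : Prop :=
  tangent_cotangent z X /\
  forall Y, tangent_cotangent z Y -> omega eta X Y = - ('d H z Y : R).

Definition hamiltonian_solution (eta : R) (H : phase R n -> R) (I : set R)
    (z : R -> phase R n) : Prop :=
  forall t, I t ->
    [/\ cotangent_stiefel2 (z t), derivable z t 1 &
        hamiltonian_vector eta H (z t) ('D_1 z t)].

Definition H_kappa (kappa : R) (V : 'cV[R]_n -> 'cV[R]_n -> R) z : R :=
  2^-1 * dotp (p1 z) (p1 z) + 2^-1 * dotp (p2 z) (p2 z)
  - (1 + 2 * kappa) * (dotp (p1 z) (e2 z) * dotp (p2 z) (e1 z))
  + V (e1 z) (e2 z).

Definition V_II (chi1 chi2 : R) (gamma1 gamma2 : 'cV[R]_n) x y : R :=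
  chi1 * dotp gamma1 x + chi2 * dotp gamma2 y.

Definition Phi (eta : R) z : 'M[R]_n :=
  wedge (p1 z) (e1 z) + wedge (p2 z) (e2 z) + eta *: wedge (e1 z) (e2 z).

Definition Psi z : R := dotp (e1 z) (p2 z) - dotp (e2 z) (p1 z).

(* The size n + 2 is written n + (1 + 1) to match the block decomposition. *)
Definition lax_L (eta chi1 chi2 : R) (gamma1 gamma2 : 'cV[R]_n) (lambda : R) z :
    'M[R]_(n + (1 + 1)) :=
  block_mx
    (- (lambda *: Phi eta z))
    (row_mx (e1 z + (lambda ^+ 2 * chi1) *: gamma1)
            (e2 z + (lambda ^+ 2 * chi2) *: gamma2))
    (col_mx (- (e1 z)^T - (lambda ^+ 2 * chi1) *: gamma1^T)
            (- (e2 z)^T - (lambda ^+ 2 * chi2) *: gamma2^T))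
    (block_mx 0 (lambda * (Psi z - eta))%:M
              (lambda * (eta - Psi z))%:M 0).

Definition lax_A (eta chi1 chi2 : R) (gamma1 gamma2 : 'cV[R]_n) (lambda : R) z :
    'M[R]_(n + (1 + 1)) :=
  block_mx
    (- Phi eta z)
    (row_mx ((lambda * chi1) *: gamma1) ((lambda * chi2) *: gamma2))
    (col_mx (- ((lambda * chi1) *: gamma1^T)) (- ((lambda * chi2) *: gamma2^T)))
    (block_mx 0 (Psi z - eta)%:M (eta - Psi z)%:M 0).

End definitions.

(* Main.v *)
Require Import Defs.
From mathcomp Require Import all_boot all_order all_algebra.
From mathcomp Require Import all_classical all_reals all_analysis.
From mathcomp Require Import ring lra.

Set Implicit Arguments.
Unset Strict Implicit.
Unset Printing Implicit Defensive.

Import Order.TTheory GRing.Theory Num.Theory.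
Import numFieldNormedType.Exports.

Local Open Scope classical_set_scope.
Local Open Scope ring_scope.

(**
  Write v = <p2, e1> = - <p1, e2>.  Instead of solving for the Lagrange
  multipliers of the constraints, one tests the Hamiltonian vector field
  against well-chosen tangent vectors.  The vertical vector
  (0, 0, H_{p1} - e1', H_{p2} - e2') turns out to be tangent, which gives
  e1' = p1 - 3 v e2 and e2' = p2 + 3 v e1; the infinitesimal rotations of R^n
  and of the plane (e1, e2) are tangent and preserve the kinetic part of H, so
  that, by Noether's argument, Phi' and Psi' come from the potential alone.
  Finally L = lambda A + B with B independent of lambda, so that
  [L, A] = [B, A], a product of blocks involving only Phi e1, Phi e2 and Psi.
*)

(** * Differentials of linear maps, matrix entries, inner products and the four projections of phase
    space *)

Lemma is_diff_lin (R : numFieldType) (V W : normedModType R)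
    (f : {linear V -> W}) (x : V) : continuous f -> is_diff x f f.
Proof.
by move=> cf; apply: DiffDef; [exact: linear_differentiable|rewrite diff_lin].
Qed.

Lemma is_diff_fst (R : numFieldType) (V W : normedModType R) (x : V * W) :
  is_diff x fst fst.
Proof. by apply: is_diff_lin => y; exact: cvg_fst. Qed.

Lemma is_diff_snd (R : numFieldType) (V W : normedModType R) (x : V * W) :
  is_diff x snd snd.
Proof. by apply: is_diff_lin => y; exact: cvg_snd. Qed.

Lemma is_diff_coord (R : realType) (V : normedModType R) m n
    (f df : V -> 'M[R]_(m, n)) x i j :
  is_diff x f df -> is_diff x (fun w => f w i j) (fun h => df h i j).
Proof.
move=> fdf.
(* The entry map [N |-> N i j] is packaged as a linear map, so that its continuity alone makes it
   its own differential. *)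
have @c : {linear 'M[R]_(m, n) -> R}.
  by exists (fun N : 'M[R]_(_, _) => N i j); do 2![eexists]; do ?[constructor];
     rewrite ?mxE// => ? *; rewrite ?mxE//; move=> ?; rewrite !mxE.
have dc : is_diff (f x) c c by apply: is_diff_lin; exact: coord_continuous.
exact: is_diff_comp fdf dc.
Qed.

Lemma is_diff_sum (R : numFieldType) (V W : normedModType R) n
    (f df : 'I_n -> V -> W) (x : V) :
  (forall i, is_diff x (f i) (df i)) ->
  is_diff x (\sum_(i < n) f i) (\sum_(i < n) df i).
Proof.
by elim/big_ind2 : _ => // [|] *; [exact: is_diff_cst|exact: is_diffD].
Qed.

Lemma diff_is_diff (R : numFieldType) (V W : normedModType R)
    (f df : V -> W) x h :
  is_diff x f df -> 'd f x h = df h.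
Proof. by move=> fdf; rewrite diff_val. Qed.

Section calculus.
Context {R : realType} {n : nat}.
Implicit Types z : phase R n.

Lemma is_diff_dotp (V : normedModType R) (f g df dg : V -> 'cV[R]_n) (x : V) :
  is_diff x f df -> is_diff x g dg ->
  is_diff x (fun w => dotp (f w) (g w))
    (fun h => dotp (f x) (dg h) + dotp (df h) (g x)).
Proof.
move=> fdf gdg.
have -> : (fun w => dotp (f w) (g w)) =
    \sum_(i < n) ((fun w => f w i 0) * (fun w => g w i 0)).
  by apply/funext => w; rewrite fct_sumE.
have dc i : is_diff x ((fun w => f w i 0) * (fun w => g w i 0))
    (f x i 0 *: (fun h => dg h i 0) + g x i 0 *: (fun h => df h i 0)).
  by apply: is_diffM; exact: is_diff_coord.
apply: (is_diff_eq (is_diff_sum dc)).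
apply/funext => h; rewrite fct_sumE /dotp -big_split /=.
by apply: eq_bigr => i _; rewrite [df h i 0 * _]mulrC.
Qed.

Lemma is_diff_e1 z : is_diff z (e1 : phase R n -> 'cV[R]_n) e1.
Proof.
exact: (is_diff_comp (is_diff_comp (is_diff_fst _) (is_diff_fst _))
                     (is_diff_fst _)).
Qed.

Lemma is_diff_e2 z : is_diff z (e2 : phase R n -> 'cV[R]_n) e2.
Proof.
exact: (is_diff_comp (is_diff_comp (is_diff_fst _) (is_diff_fst _))
                     (is_diff_snd _)).
Qed.

Lemma is_diff_p1 z : is_diff z (p1 : phase R n -> 'cV[R]_n) p1.
Proof. exact: (is_diff_comp (is_diff_fst _) (is_diff_snd _)). Qed.

Lemma is_diff_p2 z : is_diff z (p2 : phase R n -> 'cV[R]_n) p2.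
Proof. exact: is_diff_snd. Qed.

End calculus.

(** * Algebra of the inner product and of the wedge *)

Section dotp.
Context {R : realType} {n : nat}.
Implicit Types (x y : 'cV[R]_n).

Lemma dotpC x y : dotp x y = dotp y x.
Proof. by apply: eq_bigr => i _; rewrite mulrC. Qed.

Lemma dotpDl x x' y : dotp (x + x') y = dotp x y + dotp x' y.
Proof. by rewrite -big_split; apply: eq_bigr => i _; rewrite mxE mulrDl. Qed.

Lemma dotpZl a x y : dotp (a *: x) y = a * dotp x y.
Proof.
by rewrite /dotp mulr_sumr; apply: eq_bigr => i _; rewrite mxE mulrA.
Qed.

Lemma dotpNl x y : dotp (- x) y = - dotp x y.
Proof. by rewrite -scaleN1r dotpZl mulN1r. Qed.

Lemma dotpDr x y y' : dotp x (y + y') = dotp x y + dotp x y'.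
Proof. by rewrite dotpC dotpDl !(dotpC x). Qed.

Lemma dotpZr a x y : dotp x (a *: y) = a * dotp x y.
Proof. by rewrite dotpC dotpZl dotpC. Qed.

Lemma dotpNr x y : dotp x (- y) = - dotp x y.
Proof. by rewrite dotpC dotpNl dotpC. Qed.

Lemma dotp0l x : dotp 0 x = 0.
Proof. by rewrite -(scale0r x) dotpZl mul0r. Qed.

Lemma dotp0r x : dotp x 0 = 0.
Proof. by rewrite dotpC dotp0l. Qed.

Definition dotpE := (dotpDl, dotpDr, dotpNl, dotpNr, dotpZl, dotpZr,
  dotp0l, dotp0r).

Lemma dotp_ge0 x : 0 <= dotp x x.
Proof. by apply: sumr_ge0 => i _; rewrite -expr2 sqr_ge0. Qed.

Lemma dotp_eq0 x : dotp x x = 0 -> x = 0.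
Proof.
move=> /eqP; rewrite psumr_eq0 => [/allP x0|i _]; last first.
  by rewrite -expr2 sqr_ge0.
apply/matrixP => i j; rewrite ord1 mxE.
by have := x0 i (mem_index_enum i); rewrite mulf_eq0 orbb => /eqP.
Qed.

Lemma dotp_delta i x : dotp (delta_mx i 0) x = x i 0.
Proof.
rewrite /dotp (bigD1 i)//= big1 ?mxE ?eqxx ?mul1r ?addr0// => k ki.
by rewrite mxE (negPf ki) mul0r.
Qed.

Lemma dotp_mulmx x y : x^T *m y = (dotp x y)%:M.
Proof.
apply/matrixP => i j; rewrite !ord1 !mxE mulr1n.
by apply: eq_bigr => k _; rewrite mxE.
Qed.

Lemma mulmx_wedge x y v : wedge x y *m v = dotp y v *: x - dotp x v *: y.
Proof. by rewrite mulmxBl -!mulmxA !dotp_mulmx !mul_mx_scalar. Qed.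

Lemma tr_wedge x y : (wedge x y)^T = - wedge x y.
Proof. by rewrite /wedge linearB /= !trmx_mul !trmxK opprB. Qed.

Lemma wedgeE x y i j : wedge x y i j = x i 0 * y j 0 - y i 0 * x j 0.
Proof. by rewrite !mxE !big_ord1 !mxE. Qed.

End dotp.

(** * Explicit tangent space and differential of the Hamiltonian *)

Section hamiltonian.
Context {R : realType} {n : nat}.
Implicit Types (z X Y : phase R n).

Lemma phaseE (a b c d : 'cV[R]_n) :
  (e1 (a, b, c, d) = a) * (e2 (a, b, c, d) = b) *
  (p1 (a, b, c, d) = c) * (p2 (a, b, c, d) = d).
Proof. by []. Qed.

Lemma tangentP z X : tangent_cotangent z X <->
  [/\ dotp (e1 z) (e1 X) = 0, dotp (e2 z) (e2 X) = 0 &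
      dotp (e1 z) (e2 X) + dotp (e1 X) (e2 z) = 0] /\
  [/\ dotp (e1 z) (p1 X) + dotp (e1 X) (p1 z) = 0,
      dotp (e2 z) (p2 X) + dotp (e2 X) (p2 z) = 0 &
      (dotp (e1 z) (p2 X) + dotp (e1 X) (p2 z)) +
      (dotp (e2 z) (p1 X) + dotp (e2 X) (p1 z)) = 0].
Proof.
have de1 := is_diff_e1 z; have de2 := is_diff_e2 z.
have dp1 := is_diff_p1 z; have dp2 := is_diff_p2 z.
rewrite /tangent_cotangent/=.
rewrite (diff_is_diff X (is_diff_dotp de1 de1)).
rewrite (diff_is_diff X (is_diff_dotp de2 de2)).
rewrite (diff_is_diff X (is_diff_dotp de1 de2)).
rewrite (diff_is_diff X (is_diff_dotp de1 dp1)).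
rewrite (diff_is_diff X (is_diff_dotp de2 dp2)).
rewrite (diff_is_diff X
  (is_diffD (is_diff_dotp de1 dp2) (is_diff_dotp de2 dp1))) /=.
(* Differentiating [<e1, e1>] and [<e2, e2>] gives each pairing twice; the factor 2 is cancelled
   here. *)
have dbl x y : dotp x y + dotp y x = 0 <-> dotp x y = 0 :> R.
  rewrite (dotpC y) -mulr2n; split=> [/eqP|->]; last by rewrite mul0rn.
  by rewrite mulrn_eq0 /= => /eqP.
by split=> -[[/dbl ? /dbl ? ?] ?].
Qed.

Lemma diff_H_kappa kappa chi1 chi2 (gamma1 gamma2 : 'cV[R]_n) z Y :
  'd (H_kappa kappa (V_II chi1 chi2 gamma1 gamma2)) z Y =
  dotp (p1 z) (p1 Y) + dotp (p2 z) (p2 Y)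
  - (1 + 2 * kappa) *
    (dotp (p1 z) (e2 z) * (dotp (p2 z) (e1 Y) + dotp (p2 Y) (e1 z)) +
     dotp (p2 z) (e1 z) * (dotp (p1 z) (e2 Y) + dotp (p1 Y) (e2 z)))
  + (chi1 * dotp gamma1 (e1 Y) + chi2 * dotp gamma2 (e2 Y)).
Proof.
have de1 := is_diff_e1 z; have de2 := is_diff_e2 z.
have dp1 := is_diff_p1 z; have dp2 := is_diff_p2 z.
have dT1 := is_diffZ 2^-1 (is_diff_dotp dp1 dp1).
have dT2 := is_diffZ 2^-1 (is_diff_dotp dp2 dp2).
have dM := is_diffZ (1 + 2 * kappa)
  (is_diffM (is_diff_dotp dp1 de2) (is_diff_dotp dp2 de1)).
have dV1 := is_diffZ chi1 (is_diff_dotp (is_diff_cst gamma1 z) de1).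
have dV2 := is_diffZ chi2 (is_diff_dotp (is_diff_cst gamma2 z) de2).
have dH := is_diffD (is_diffB (is_diffD dT1 dT2) dM) (is_diffD dV1 dV2).
rewrite (diff_is_diff Y dH) !fctE /= !dotp0l !addr0.
rewrite (dotpC (p1 Y) (p1 z)) (dotpC (p2 Y) (p2 z)) /GRing.scale /=.
by field.
Qed.

End hamiltonian.

(** * Equations of motion from test vectors *)

Section equations_of_motion.
Context {R : realType} {n : nat}.
Variables (eta chi1 chi2 : R) (gamma1 gamma2 : 'cV[R]_n) (z X : phase R n).
Hypothesis z_cot : cotangent_stiefel2 z.
Hypothesis X_ham :
  hamiltonian_vector eta (H_kappa 1 (V_II chi1 chi2 gamma1 gamma2)) z X.

(** A set of rewriting rules: on the cotangent bundle every pairing of an [e] with an [e] or a [p]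
    becomes a constant or [v = <p2, e1>] up to sign. Both orders of the arguments are listed, since
    rewriting does not see symmetry. *)
Lemma cotangentE :
  ((dotp (e1 z) (e1 z) = 1) * (dotp (e2 z) (e2 z) = 1)) *
  ((dotp (e1 z) (e2 z) = 0) * (dotp (e2 z) (e1 z) = 0)) *
  ((dotp (e1 z) (p1 z) = 0) * (dotp (p1 z) (e1 z) = 0)) *
  ((dotp (e2 z) (p2 z) = 0) * (dotp (p2 z) (e2 z) = 0)) *
  ((dotp (e1 z) (p2 z) = dotp (p2 z) (e1 z)) *
   (dotp (e2 z) (p1 z) = - dotp (p2 z) (e1 z)) *
   (dotp (p1 z) (e2 z) = - dotp (p2 z) (e1 z))).
Proof.
case: z_cot => -[/= ? ? ?] ? ?; rewrite !(dotpC (p2 z)) !(dotpC (p1 z)).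
rewrite (dotpC (e2 z) (e1 z)) addrC => /eqP; rewrite addr_eq0 => /eqP ?.
by do ![split].
Qed.

Lemma hamilton_e :
  e1 X = p1 z - (3 * dotp (p2 z) (e1 z)) *: e2 z /\
  e2 X = p2 z + (3 * dotp (p2 z) (e1 z)) *: e1 z.
Proof.
set v := dotp (p2 z) (e1 z).
(* The vertical test vector is [(0, 0, d1, d2)] with [d1 = H_{p1} - e1'] and [d2 = H_{p2} - e2']. In
   the third momentum constraint the contributions [3 v] and [- 3 v] cancel, and so do those of [X],
   by its own tangency. *)
have [/tangentP[[t1 t2 t3] _] /(_ (0, 0, p1 z - (3 * v) *: e2 z - e1 X,
  p2 z + (3 * v) *: e1 z - e2 X))] := X_ham.
rewrite tangentP diff_H_kappa /omega !phaseE !dotpE !cotangentE -/v.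
have t12 : dotp (e1 z) (e2 X) = - dotp (e1 X) (e2 z).
  by apply/eqP; rewrite -addr_eq0 t3.
rewrite t1 t2 (dotpC (e2 z) (e1 X)) (dotpC (e2 X) (e1 z)) t12.
move=> /(_ _)/wrap[]; first by split; split; ring.
move=> E; pose d1 := p1 z - (3 * v) *: e2 z - e1 X.
pose d2 := p2 z + (3 * v) *: e1 z - e2 X.
(* On this vector [E] says [<d1, e1'> + <d2, e2'> = <d1, H_{p1}> + <d2, H_{p2}>], so the sum of
   squares vanishes. *)
have : dotp d1 d1 + dotp d2 d2 = 0.
  rewrite /d1 /d2 !dotpE !cotangentE -/v.
  rewrite (dotpC (e1 X) (p1 z)) (dotpC (e2 X) (p2 z)) (dotpC (e2 z) (e1 X)).
  by rewrite (dotpC (e2 X) (e1 z)) t12; lra.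
move=> /eqP; rewrite paddr_eq0 ?dotp_ge0// => /andP[/eqP/dotp_eq0 d10].
move=> /eqP/dotp_eq0 d20.
by split; apply/esym/subr0_eq.
Qed.

(** The left side is the derivative of [Phi] along [X]. Its [(i, j)] entry is [omega] of [X] and the
    generator of a simultaneous rotation of [e1, e2, p1, p2]; such a rotation preserves all inner
    products among them, so [dH] on the generator keeps only the potential terms. *)
Lemma hamilton_Phi :
  (wedge (p1 X) (e1 z) + wedge (p1 z) (e1 X)) +
  (wedge (p2 X) (e2 z) + wedge (p2 z) (e2 X)) +
  eta *: (wedge (e1 X) (e2 z) + wedge (e1 z) (e2 X)) =
  - (chi1 *: wedge gamma1 (e1 z) + chi2 *: wedge gamma2 (e2 z)).
Proof.
apply/matrixP => i j.
(* Pairing with the infinitesimal rotation xi extracts an entry of a wedge. *)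
pose xi : 'M[R]_n := wedge (delta_mx i 0) (delta_mx j 0).
have xiE x y : dotp x (xi *m y) = wedge x y i j.
  by rewrite mulmx_wedge !dotpE !(dotpC _ (delta_mx _ _)) !dotp_delta wedgeE
             mulrC [y i 0 * _]mulrC.
have [_ /(_ (xi *m e1 z, xi *m e2 z, xi *m p1 z, xi *m p2 z))] := X_ham.
rewrite tangentP diff_H_kappa /omega !phaseE !(dotpC (xi *m _)) !xiE.
move=> /(_ _)/wrap[]; first by rewrite !wedgeE; split; split; ring.
by rewrite !wedgeE !mxE !big_ord1 !mxE; lra.
Qed.

(** The test vector generates the rotation of the pairs [(e1, e2)] and [(p1, p2)] by a common angle.
    The mixed term of [H] does not vary because [<e1, p1> = <e2, p2> = 0], and the [eta] part of
    [omega] vanishes because [X] keeps [e1] and [e2] of unit length. *)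
Lemma hamilton_Psi :
  (dotp (e1 X) (p2 z) + dotp (e1 z) (p2 X)) -
  (dotp (e2 X) (p1 z) + dotp (e2 z) (p1 X)) =
  chi1 * dotp gamma1 (e2 z) - chi2 * dotp gamma2 (e1 z).
Proof.
have [/tangentP[[t1 t2 _] _] /(_ (e2 z, - e1 z, p2 z, - p1 z))] := X_ham.
rewrite tangentP diff_H_kappa /omega !phaseE !dotpE !cotangentE t2.
rewrite (dotpC (e1 X) (e1 z)) t1.
move=> /(_ _)/wrap[]; first by split; split; ring.
rewrite (dotpC (p1 X)) (dotpC (p2 X)) (dotpC (e1 X)) (dotpC (e2 X)).
rewrite (dotpC (p1 z) (p2 z)).
by lra.
Qed.

End equations_of_motion.

(** * Derivatives of matrix-valued functions, entry by entry and block by block *)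

Section is_derive_matrix.
Context {R : realFieldType} {V : normedModType R}.
Implicit Types (x v : V).

(** Chain rule along a curve: in one real variable derivability already gives differentiability, so
    the two differentials compose. *)
Lemma is_derive_comp_diff (U W : normedModType R) (f df : U -> W) (g : R -> U)
    (t : R) :
  derivable g t 1 -> is_diff (g t) f df ->
  is_derive t 1 (fun s => f (g s)) (df ('D_1 g t)).
Proof.
move=> /derivable1_diffP dg fdf.
have df_gt : differentiable f (g t) by [].
have dfg := differentiable_comp dg df_gt.
apply: DeriveDef; first exact: diff_derivable.
by rewrite deriveE// diff_comp//= diff_val deriveE.
Qed.

Lemma is_derive_mx m n (F : V -> 'M[R]_(m, n)) (D : 'M[R]_(m, n)) x v :
  (forall i j, is_derive x v (fun y => F y i j) (D i j)) ->
  is_derive x v F D.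
Proof.
move=> dF; have dvF : derivable F x v by apply/derivable_mxP => i j.
apply: DeriveDef => //; rewrite derive_mx//.
by apply/matrixP => i j; rewrite mxE derive_val.
Qed.

Lemma is_derive_coord m n (F : V -> 'M[R]_(m, n)) (D : 'M[R]_(m, n)) x v i j :
  is_derive x v F D -> is_derive x v (fun y => F y i j) (D i j).
Proof.
move=> dF; have dvF : derivable F x v by [].
have [+ _] := derivable_mxP F x v => /(_ dvF i j) dij.
apply: DeriveDef => //; have <- : 'D_v F x = D by rewrite derive_val.
by rewrite derive_mx// mxE.
Qed.

Lemma is_derive_row_mx m n1 n2 (F : V -> 'M[R]_(m, n1)) (G : V -> 'M[R]_(m, n2))
    D E x v :
  is_derive x v F D -> is_derive x v G E ->
  is_derive x v (fun y => row_mx (F y) (G y)) (row_mx D E).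
Proof.
move=> dF dG; apply: is_derive_mx => i j; case: (split_ordP j) => k ->.
  rewrite row_mxEl (_ : (fun _ => _) = fun y => F y i k).
    exact: is_derive_coord.
  by apply/funext => y; rewrite row_mxEl.
rewrite row_mxEr (_ : (fun _ => _) = fun y => G y i k).
  exact: is_derive_coord.
by apply/funext => y; rewrite row_mxEr.
Qed.

Lemma is_derive_trmx m n (F : V -> 'M[R]_(m, n)) D x v :
  is_derive x v F D -> is_derive x v (fun y => (F y)^T) D^T.
Proof.
move=> dF; apply: is_derive_mx => i j; rewrite mxE.
rewrite (_ : (fun _ => _) = fun y => F y j i); first exact: is_derive_coord.
by apply/funext => y; rewrite mxE.
Qed.

Lemma is_derive_col_mx m1 m2 n (F : V -> 'M[R]_(m1, n)) (G : V -> 'M[R]_(m2, n))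
    D E x v :
  is_derive x v F D -> is_derive x v G E ->
  is_derive x v (fun y => col_mx (F y) (G y)) (col_mx D E).
Proof.
(* Stacking is the transpose of juxtaposing the transposes, which reduces the claim to [row_mx]. *)
move=> dF dG; rewrite -[col_mx D E]trmxK tr_col_mx.
rewrite (_ : (fun _ => _) = fun y => (row_mx (F y)^T (G y)^T)^T).
  by apply: is_derive_trmx; apply: is_derive_row_mx; exact: is_derive_trmx.
by apply/funext => y; rewrite tr_row_mx !trmxK.
Qed.

Lemma is_derive_scalar_mx n (f : V -> R) d x v :
  is_derive x v f d -> is_derive x v (fun y => (f y)%:M : 'M[R]_n) d%:M.
Proof.
move=> df; apply: is_derive_mx => i j; rewrite mxE -mulr_natl.
rewrite (_ : (fun _ => _) = (i == j)%:R *: f).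
  by apply: (is_derive_eq (is_deriveZ _ df)).
by apply/funext => y; rewrite mxE -[LHS]mulr_natl.
Qed.

Lemma is_derive_mulmx m n p (F : V -> 'M[R]_(m, n)) (G : V -> 'M[R]_(n, p))
    D E x v :
  is_derive x v F D -> is_derive x v G E ->
  is_derive x v (fun y => F y *m G y) (D *m G x + F x *m E).
Proof.
move=> dF dG; apply: is_derive_mx => i j.
rewrite (_ : (fun _ => _) =
    \sum_(k < n) ((fun y => F y i k) * (fun y => G y k j))); last first.
  by apply/funext => y; rewrite mxE fct_sumE.
have dk k : is_derive x v ((fun y => F y i k) * (fun y => G y k j))
    (F x i k *: E k j + G x k j *: D i k).
  by apply: is_deriveM; exact: is_derive_coord.
apply: (is_derive_eq (is_derive_sum dk)).
rewrite !mxE -big_split; apply: eq_bigr => k _.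
by rewrite addrC /GRing.scale/= [D i k * _]mulrC.
Qed.

End is_derive_matrix.

Lemma is_derive_wedge (R : realType) (V : normedModType R) n
    (f g : V -> 'cV[R]_n) df dg x v :
  is_derive x v f df -> is_derive x v g dg ->
  is_derive x v (fun y => wedge (f y) (g y)) (wedge df (g x) + wedge (f x) dg).
Proof.
move=> dfx dgx; have dfT := is_derive_trmx dfx; have dgT := is_derive_trmx dgx.
apply: (is_derive_eq
  (is_deriveB (is_derive_mulmx dfx dgT) (is_derive_mulmx dgx dfT))).
by rewrite /wedge opprD [- _ - _]addrC addrACA.
Qed.

(** * Skew-symmetry of the Lax matrices and their commutator *)

Lemma commutator_scale_addl (R : realType) n a (A B : 'M[R]_n) :
  commutator (a *: A + B) A = commutator B A.
Proof.
by rewrite /commutator mulmxDl mulmxDr -scalemxAl -scalemxAr opprD addrACA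
  subrr add0r.
Qed.

Lemma block_mx_skew (R : fieldType) m n (U : 'M[R]_m) (B : 'M[R]_(m, n))
    (W : 'M[R]_n) :
  U^T = - U -> W^T = - W -> block_mx U B (- B^T) W \is skewmx.
Proof.
(* [skewmx] is the hermitian predicate with sign [-1] and the identity as conjugation. *)
move=> UT WT; apply/is_hermitianmxP; rewrite expr1 scaleN1r map_mx_id//.
by rewrite tr_block_mx UT WT linearN /= trmxK opp_block_mx !opprK.
Qed.

Lemma tr_block_scalar_skew (R : fieldType) n (a : R) :
  (block_mx 0 a%:M (- a)%:M 0)^T =
  - block_mx 0 a%:M (- a)%:M 0 :> 'M[R]_(n + n).
Proof.
by rewrite tr_block_mx !tr_scalar_mx !trmx0 opp_block_mx oppr0 raddfN opprK.
Qed.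

Section lax_pair.
Context {R : realType} {n : nat}.
Variables (eta chi1 chi2 : R) (gamma1 gamma2 : 'cV[R]_n) (lambda : R).
Variable z : phase R n.
Let L := lax_L eta chi1 chi2 gamma1 gamma2 lambda z.
Let A := lax_A eta chi1 chi2 gamma1 gamma2 lambda z.

Lemma tr_Phi : (Phi eta z)^T = - Phi eta z.
Proof. by rewrite /Phi 2!linearD linearZ /= !tr_wedge scalerN !opprD. Qed.

Lemma lax_L_skew : L \is skewmx.
Proof.
rewrite /L /lax_L; set B := row_mx _ _; set C := col_mx _ _.
have -> : C = - B^T.
  by rewrite /B tr_row_mx opp_col_mx !linearD /= !linearZ /= !scalerN.
apply: block_mx_skew; first by rewrite linearN linearZ /= tr_Phi scalerN.
by rewrite -[eta - _]opprB mulrN tr_block_scalar_skew.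
Qed.

Lemma lax_A_skew : A \is skewmx.
Proof.
rewrite /A /lax_A; set B := row_mx _ _; set C := col_mx _ _.
have -> : C = - B^T by rewrite /B tr_row_mx opp_col_mx !linearZ /= !scalerN.
apply: block_mx_skew; first by rewrite linearN /= tr_Phi.
by rewrite -[eta - _]opprB tr_block_scalar_skew.
Qed.

(** Every term of [L] carrying a power of [lambda] is [lambda] times the corresponding term of [A].
    Since [A] commutes with itself, only the remainder, built from [e1] and [e2], contributes to the
    commutator. *)
Lemma lax_LE : L = lambda *: A +
  block_mx 0 (row_mx (e1 z) (e2 z)) (col_mx (- (e1 z)^T) (- (e2 z)^T)) 0.
Proof.
rewrite /L /A /lax_L /lax_A !scale_block_mx scale_row_mx scale_col_mx.
rewrite !add_block_mx add_row_mx add_col_mx !addr0 !scalerN !scalerA !scaler0.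
rewrite !scale_scalar_mx mulrA -expr2 mulrA -expr2.
by rewrite ![_ *: gamma1 + _]addrC ![_ *: gamma2 + _]addrC
  ![- (e1 z)^T - _]addrC ![- (e2 z)^T - _]addrC.
Qed.

Lemma Phi_mul : cotangent_stiefel2 z ->
  (Phi eta z *m e1 z = p1 z - (dotp (p2 z) (e1 z) + eta) *: e2 z) *
  (Phi eta z *m e2 z = p2 z + (dotp (p2 z) (e1 z) + eta) *: e1 z).
Proof.
move=> zc; split; rewrite /Phi 2!mulmxDl -!scalemxAl !mulmx_wedge;
  by rewrite !(cotangentE zc); apply/matrixP => i j; rewrite !mxE; ring.
Qed.

Lemma commutator_lax : cotangent_stiefel2 z ->
  let v := dotp (p2 z) (e1 z) in
  let m := lambda * (chi1 * dotp gamma1 (e2 z) - chi2 * dotp gamma2 (e1 z)) in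
  commutator L A = block_mx
    (lambda *: (chi1 *: wedge gamma1 (e1 z) + chi2 *: wedge gamma2 (e2 z)))
    (row_mx (p1 z - (3 * v) *: e2 z) (p2 z + (3 * v) *: e1 z))
    (col_mx (- (p1 z - (3 * v) *: e2 z)^T) (- (p2 z + (3 * v) *: e1 z)^T))
    (block_mx 0 m%:M (- m)%:M 0).
Proof.
move=> zc v m; rewrite lax_LE commutator_scale_addl /commutator /A /lax_A.
rewrite !mulmx_block !mul0mx !mulmx0 !addr0 !add0r.
rewrite !mul_row_block !mul_block_col !mul_row_col !mul_col_row.
rewrite !mul_mx_row !mul_col_mx !mul0mx !mulmx0 !addr0 !add0r.
rewrite opp_block_mx !add_block_mx !opp_row_mx !add_row_mx.
rewrite !opp_col_mx !add_col_mx.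
(* The constraint [<e1, p2> + <e2, p1> = 0] makes the two terms of [Psi] equal. *)
have PsiE : Psi z = 2 * v by rewrite /Psi !(cotangentE zc) -/v; ring.
have Phi_tr x : x^T *m Phi eta z = - (Phi eta z *m x)^T.
  by rewrite trmx_mul tr_Phi mulmxN opprK.
congr block_mx.
- by apply/matrixP => i j; rewrite !mxE !big_ord1 !mxE; ring.
(* Here [kappa = 1] matters: [Phi e1] contributes [- (v + eta) e2] and the corner of [A] contributes
   [(eta - 2 v) e2]. The [eta] cancels, leaving [- 3 v e2], where [3 = 1 + 2 kappa] is the
   coefficient in [e1']. The second column is alike. *)
- rewrite !mul_mx_scalar !mulNmx !(Phi_mul zc) PsiE -/v.
  by congr row_mx; apply/matrixP => i j; rewrite !mxE; ring.
- rewrite !mulNmx !mulmxN !opprK !Phi_tr !mul_scalar_mx !(Phi_mul zc) PsiE -/v.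
  by congr col_mx; apply/matrixP => i j; rewrite !mxE; ring.
(* In the lower right corner the products are scalars: the diagonal ones cancel and the others give
   [m] and [- m]. *)
rewrite /block_mx !opp_row_mx !add_row_mx.
rewrite !mulNmx -!scalemxAl -!scalemxAr !dotp_mulmx /m.
rewrite !(dotpC _ gamma1) !(dotpC _ gamma2).
by congr col_mx; congr row_mx; apply/matrixP => i j;
  rewrite !ord1 !mxE eqxx !mulr1n; ring.
Qed.

End lax_pair.

(** * The Lax equation along a Hamiltonian solution *)

Theorem theorem4 (R : realType) (n : nat) (hn : (3 <= n)%N)
    (eta chi1 chi2 : R) (gamma1 gamma2 : 'cV[R]_n)
    (hgamma1 : dotp gamma1 gamma1 = 1) (hgamma2 : dotp gamma2 gamma2 = 1)
    (I : set R) (I_open : open I) (I_itv : is_interval I)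
    (z : R -> phase R n)
    (hz : hamiltonian_solution eta
            (H_kappa 1 (V_II chi1 chi2 gamma1 gamma2)) I z) :
  forall (t : R) (lambda : R), I t ->
    let L := lax_L eta chi1 chi2 gamma1 gamma2 lambda in
    let A := lax_A eta chi1 chi2 gamma1 gamma2 lambda in
    [/\ L (z t) \is skewmx, A (z t) \is skewmx &
        is_derive t 1 (fun s => L (z s)) (commutator (L (z t)) (A (z t)))].
Proof.
move=> t lambda It L A; have [zt_cot dz zt_ham] := hz _ It.
split; [exact: lax_L_skew | exact: lax_A_skew | ].
(* The off-diagonal blocks of the commutator are recognized as the velocities of [e1] and [e2]. *)
rewrite commutator_lax//; have [<- <-] := hamilton_e zt_cot zt_ham.
have de1 := is_derive_comp_diff dz (is_diff_e1 (z t)).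
have de2 := is_derive_comp_diff dz (is_diff_e2 (z t)).
have dp1 := is_derive_comp_diff dz (is_diff_p1 (z t)).
have dp2 := is_derive_comp_diff dz (is_diff_p2 (z t)).
have dPhi : is_derive t 1 (fun s => Phi eta (z s))
    (- (chi1 *: wedge gamma1 (e1 (z t)) + chi2 *: wedge gamma2 (e2 (z t)))).
  rewrite -(hamilton_Phi zt_ham); exact: (is_deriveD (is_deriveD
    (is_derive_wedge dp1 de1) (is_derive_wedge dp2 de2))
    (is_deriveZ eta (is_derive_wedge de1 de2))).
have dPsi : is_derive t 1 (fun s => Psi (z s))
    (chi1 * dotp gamma1 (e2 (z t)) - chi2 * dotp gamma2 (e1 (z t))).
  rewrite -(hamilton_Psi zt_cot zt_ham).
  have dd := is_diffB (is_diff_dotp (is_diff_e1 (z t)) (is_diff_p2 (z t)))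
                      (is_diff_dotp (is_diff_e2 (z t)) (is_diff_p1 (z t))).
  apply: (is_derive_eq (is_derive_comp_diff dz dd)).
  by rewrite /= !fctE; ring.
(* Each block is differentiated separately: the [gamma] terms and [eta] are constant in time, and
   the sign of [Phi'] is absorbed by the minus in front of [lambda *: Phi]. *)
apply: is_derive_col_mx; apply: is_derive_row_mx.
- apply: (is_derive_eq (is_deriveN (is_deriveZ lambda dPhi))).
  by rewrite scalerN opprK.
- apply: is_derive_row_mx.
  + apply: (is_derive_eq (is_deriveD de1 (is_derive_cst _ _ _))).
    by rewrite addr0.
  + apply: (is_derive_eq (is_deriveD de2 (is_derive_cst _ _ _))).
    by rewrite addr0.
- apply: is_derive_col_mx.
  + apply: (is_derive_eq (is_deriveB (is_deriveN (is_derive_trmx de1))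
      (is_derive_cst _ _ _))).
    by rewrite subr0.
  + apply: (is_derive_eq (is_deriveB (is_deriveN (is_derive_trmx de2))
      (is_derive_cst _ _ _))).
    by rewrite subr0.
apply: is_derive_col_mx; apply: is_derive_row_mx.
- apply: is_derive_scalar_mx.
  apply: (is_derive_eq (is_deriveZ lambda
    (is_deriveB dPsi (is_derive_cst eta _ _)))).
  by rewrite subr0.
- apply: is_derive_scalar_mx.
  apply: (is_derive_eq (is_deriveZ lambda
    (is_deriveB (is_derive_cst eta _ _) dPsi))).
  by rewrite sub0r scalerN.
Qed.
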